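(* Let $(X,W)$ be a marked simplicial set. (1)(a) If $\mathrm{Ex}_+(X,W)$ is a quasicategory, then $(X,W)$ has the right lifting property with respect to $\{\mathrm{LJ}^n_k\hookrightarrow\mathrm{L}^n_k\mid n\ge2,\ 0<k\le n\}$. (1)(b) If $X$ is a quasicategory and $(X,W)$ satisfies CLF, then $\mathrm{Ex}_+(X,W)$ is a quasicategory. (2)(a) If $\mathrm{Ex}^{\mathrm{op}}_+(X,W)$ is a quasicategory, then $(X,W)$ has the right lifting property with respect to $\{\mathrm{RJ}^n_k\hookrightarrow\mathrm{R}^n_k\mid n\ge2,\ 0\le k<n\}$. (2)(b) If $X$ is a quasicategory and $(X,W)$ satisfies CRF, then $\mathrm{Ex}^{\mathrm{op}}_+(X,W)$ is a quasicategory.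
   Context: A marked simplicial set is a pair $(X,W)$ where $X$ is a simplicial set and $W \subseteq X_1$ contains all degenerate $1$-simplices; marked maps preserve marked $1$-simplices. Posets are regarded as simplicial sets via the nerve; $[n]=\{0<\dots<n\}$. For $n\ge 0$, $0\le k\le n$, $\mathrm{L}^n_k$ is the nerve of the poset of subsets $A\subseteq[n]$ with $k\in A$, ordered by inclusion, where $A_0\subseteq A_1$ is marked iff $\max A_0=\max A_1$; $\mathrm{LJ}^n_k\subseteq \mathrm{L}^n_k$ is the maximal simplicial subset not containing the vertex $[n]$. $\mathrm{R}^n_k$ is the nerve of the opposite poset (arrows $A_0\to A_1$ when $A_0\supseteq A_1$), where $A_0\supseteq A_1$ is marked iff $\min A_0=\min A_1$; $\mathrm{RJ}^n_k\subseteq\mathrm{R}^n_k$ is the maximal simplicial subset omitting the vertex $[n]$. $W$ is weakly closed under composition if every map $\Lambda^2_1\to X$ with both edges marked extends to a $2$-simplex all of whose edges are marked. A marked quasicategory $(\mathcal{C},W)$ satisfies CLF if $W$ is weakly closed under composition and it has the right lifting property against all $\mathrm{LJ}^n_k\hookrightarrow\mathrm{L}^n_k$ ($n\ge2$, $0<k\le n$); it satisfies CRF if $W$ is weakly closed under composition and it has the right lifting property against all $\mathrm{RJ}^n_k\hookrightarrow\mathrm{R}^n_k$ ($n\ge2$, $0\le k<n$). Marked Ex: $\mathrm{sd}_+[n]$ is the nerve of the poset of non-empty subsets of $[n]$ ordered by inclusion, with $A_0\subseteq A_1$ marked iff $\max A_0=\max A_1$; $\mathrm{sd}^{\mathrm{op}}_+[n]$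 is the nerve of the opposite poset, with $A_0\supseteq A_1$ marked iff $\min A_0=\min A_1$. Both are cosimplicial objects in marked simplicial sets via direct image of subsets. $\mathrm{Ex}_+(X,W)$ is the simplicial set with $n$-simplices the marked maps $\mathrm{sd}_+[n]\to(X,W)$, and $\mathrm{Ex}^{\mathrm{op}}_+(X,W)$ the simplicial set with $n$-simplices the marked maps $\mathrm{sd}^{\mathrm{op}}_+[n]\to(X,W)$. *)

(* Defs.v *)
From Stdlib Require Import FunctionalExtensionality ProofIrrelevance.
From mathcomp Require Import all_boot.
Set Implicit Arguments. Unset Strict Implicit. Unset Printing Implicit Defensive.

(* an m-simplex of the nerve of (T,r) is a monotone map [m] -> T *)
Definition is_chain (T : finType) (r : rel T) m (f : {ffun 'I_m.+1 -> T}) : bool :=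
  [forall i : 'I_m.+1, forall j : 'I_m.+1, (i <= j)%N ==> r (f i) (f j)].

Definition chain (T : finType) (r : rel T) m := {f : {ffun 'I_m.+1 -> T} | is_chain r f}.

Definition ord_le n : rel 'I_n.+1 := fun i j => (i <= j)%N.

(* monotone maps [m] -> [n], i.e. the morphisms of the simplex category *)
Definition mono m n := chain (@ord_le n) m.

Lemma is_chain_precomp (T : finType) (r : rel T) m n (s : chain r n) (t : mono m n) :
  is_chain r [ffun i => sval s (sval t i)].
Proof.
apply/forallP => i; apply/forallP => j; apply/implyP => hij; rewrite !ffunE.
move/forallP: (svalP s) => /(_ (sval t i)) /forallP /(_ (sval t j)) /implyP; apply.
by move/forallP: (svalP t) => /(_ i) /forallP /(_ j) /implyP; apply.
Qed.

Definition cprecomp (T : finType) (r : rel T) m n (s : chain r n) (t : mono m n) : chain r m :=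
  exist (fun g => is_chain r g) [ffun i => sval s (sval t i)] (is_chain_precomp s t).

Lemma is_chain_id n : is_chain (@ord_le n) [ffun i : 'I_n.+1 => i].
Proof. by apply/forallP => i; apply/forallP => j; apply/implyP; rewrite !ffunE. Qed.

Definition idm n : mono n n := exist (fun g => is_chain (@ord_le n) g) [ffun i => i] (is_chain_id n).

Lemma is_chain_const : is_chain (@ord_le 0) [ffun _ : 'I_2 => ord0].
Proof. by apply/forallP => i; apply/forallP => j; apply/implyP; rewrite !ffunE. Qed.

Definition s01 : mono 1 0 := exist (fun g => is_chain (@ord_le 0) g) [ffun _ => ord0] is_chain_const.

Record sset := SSet {
  sobj :> nat -> Type;
  sact : forall m n, mono m n -> sobj n -> sobj m;
  sact_id : forall n (x : sobj n), sact (idm n) x = x;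
  sact_comp : forall m n p (f : mono m n) (g : mono n p) (x : sobj p),
      sact (cprecomp g f) x = sact f (sact g x)
}.

Record msset := MSSet {
  mX :> sset;
  mW : mX 1 -> Prop;
  mW_degen : forall x : mX 0, mW (sact s01 x)
}.

(* A simplicial subset of the nerve of (T,r) is given by a predicate S on
   simplices (closed under the simplicial operators).  A map S -> X is a
   family F of functions on the simplices in S, natural in [m]. *)
Definition subnerve (T : finType) (r : rel T) := forall m, pred (chain r m).

Definition natural (T : finType) (r : rel T) (S : subnerve r) (X : sset)
    (F : forall m (s : chain r m), S m s -> X m) : Prop :=
  forall m n (t : mono m n) (s : chain r n) (h : S n s) (h' : S m (cprecomp s t)),
    F m (cprecomp s t) h' = sact t (F n s h).

Definition marked (T : finType) (r : rel T) (S : subnerve r) (M : rel T) (X : sset)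
    (W : X 1 -> Prop) (F : forall m (s : chain r m), S m s -> X m) : Prop :=
  forall (e : chain r 1) (h : S 1 e), M (sval e ord0) (sval e ord_max) -> W (F 1 e h).

Definition rlp (T : finType) (r : rel T) (S S' : subnerve r) (X : sset) : Prop :=
  forall F, natural F ->
  exists G : forall m (s : chain r m), S' m s -> X m, natural G /\
    forall m (s : chain r m) (h : S m s) (h' : S' m s), G m s h' = F m s h.

(* right lifting property of (X,W) against the marked inclusion S >-> S',
   both marked by M (S carries the induced marking) *)
Definition mrlp (T : finType) (r : rel T) (M : rel T) (S S' : subnerve r) (X : msset) : Prop :=
  forall F, natural F -> marked M (@mW X) F ->
  exists G : forall m (s : chain r m), S' m s -> X m, natural G /\ marked M (@mW X) G /\
    forall m (s : chain r m) (h : S m s) (h' : S' m s), G m s h' = F m s h.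

Definition full (T : finType) (r : rel T) : subnerve r := fun _ _ => true.

Definition horn n (k : 'I_n.+1) : subnerve (@ord_le n) :=
  fun m s => [exists j : 'I_n.+1, (j != k) && [forall i : 'I_m.+1, sval s i != j]].

Definition is_quasicat (X : sset) : Prop :=
  forall n (k : 'I_n.+1), (0 < k < n)%N -> rlp (horn k) (@full _ (@ord_le n)) X.

Definition sub_le n : rel {set 'I_n.+1} := fun A B => A \subset B.
Definition sup_le n : rel {set 'I_n.+1} := fun A B => B \subset A.

Definition smax n (A : {set 'I_n.+1}) : nat := \max_(i in A) (val i).
Definition smin n (A : {set 'I_n.+1}) : nat := \big[minn/n]_(i in A) (val i).

Definition mark_max n : rel {set 'I_n.+1} := fun A B => smax A == smax B.
Definition mark_min n : rel {set 'I_n.+1} := fun A B => smin A == smin B.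

(* L^n_k (resp. R^n_k): chains of subsets all containing k *)
Definition Lsub n (k : 'I_n.+1) (r : rel {set 'I_n.+1}) : subnerve r :=
  fun m s => [forall i : 'I_m.+1, k \in sval s i].
(* LJ^n_k (resp. RJ^n_k): additionally never hitting the vertex [n] *)
Definition LJsub n (k : 'I_n.+1) (r : rel {set 'I_n.+1}) : subnerve r :=
  fun m s => [forall i : 'I_m.+1, (k \in sval s i) && (sval s i != setT)].

Definition weakly_closed (X : msset) : Prop :=
  mrlp (fun _ _ : 'I_3 => true) (@horn 2 (inord 1)) (@full _ (@ord_le 2)) X.

Definition L_lifting (X : msset) : Prop :=
  forall n (k : 'I_n.+1), (2 <= n)%N -> (0 < k <= n)%N ->
    mrlp (@mark_max n) (@LJsub n k (@sub_le n)) (@Lsub n k (@sub_le n)) X.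

Definition R_lifting (X : msset) : Prop :=
  forall n (k : 'I_n.+1), (2 <= n)%N -> (k < n)%N ->
    mrlp (@mark_min n) (@LJsub n k (@sup_le n)) (@Lsub n k (@sup_le n)) X.

Definition CLF (X : msset) : Prop := weakly_closed X /\ L_lifting X.
Definition CRF (X : msset) : Prop := weakly_closed X /\ R_lifting X.

Definition sdsub n (r : rel {set 'I_n.+1}) : subnerve r :=
  fun m s => [forall i : 'I_m.+1, sval s i != set0].
Arguments sdsub {n} r {m} s.

Section ExGen.
Variable (X : msset).
Unset Implicit Arguments.
Variable (r : forall n, rel {set 'I_n.+1}) (M : forall n, rel {set 'I_n.+1}).
Set Implicit Arguments.
Hypothesis rmap : forall n' n (f : mono n' n) A B,
  r n' A B -> r n (sval f @: A) (sval f @: B).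
Hypothesis Mmap : forall n' n (f : mono n' n) A B, A != set0 -> B != set0 ->
  M n' A B -> M n (sval f @: A) (sval f @: B).

Definition Exobj n := { F : forall m (s : chain (r n) m), sdsub (r n) s -> X m |
   natural F /\ marked (M n) (@mW X) F }.

Lemma is_chain_push n' n (f : mono n' n) m (s : chain (r n') m) :
  is_chain (r n) [ffun i => sval f @: sval s i].
Proof.
apply/forallP => i; apply/forallP => j; apply/implyP => hij; rewrite !ffunE.
apply: rmap.
by move/forallP: (svalP s) => /(_ i) /forallP /(_ j) /implyP; apply.
Qed.

Definition pushc n' n (f : mono n' n) m (s : chain (r n') m) : chain (r n) m :=
  exist (fun g => is_chain (r n) g) [ffun i => sval f @: sval s i] (is_chain_push f s).

Lemma push_sd n' n (f : mono n' n) m (s : chain (r n') m) :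
  sdsub (r n') s -> sdsub (r n) (pushc f s).
Proof.
move/forallP => h; apply/forallP => i; rewrite /pushc /= ffunE.
by rewrite imset_eq0; exact: h.
Qed.

Lemma chain_eq (T : finType) (rr : rel T) m (s t : chain rr m) :
  (forall i, sval s i = sval t i) -> s = t.
Proof. by move=> h; apply: val_inj; apply/ffunP. Qed.

Lemma Fext n (F : Exobj n) m (s t : chain (r n) m) h h' :
  s = t -> sval F m s h = sval F m t h'.
Proof. by move=> e; subst t; rewrite (bool_irrelevance h h'). Qed.

Lemma Exact_nat n' n (f : mono n' n) (F : Exobj n) :
  natural (fun m s (h : sdsub (r n') s) => sval F m (pushc f s) (push_sd f h)).
Proof.
move=> m p t s h h'.
have hp : sdsub (r n) (cprecomp (pushc f s) t).
  apply/forallP => i; rewrite /= ffunE /= ffunE imset_eq0.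
  by move/forallP: h' => /(_ i); rewrite /= ffunE.
rewrite -((proj1 (svalP F)) _ _ t _ _ hp); apply: Fext.
by apply: chain_eq => i; rewrite /= !ffunE.
Qed.

Lemma Exact_mark n' n (f : mono n' n) (F : Exobj n) :
  marked (M n') (@mW X) (fun m s (h : sdsub (r n') s) => sval F m (pushc f s) (push_sd f h)).
Proof.
move=> e h hm; apply: (proj2 (svalP F)); rewrite /= !ffunE.
move/forallP: h => h; apply: Mmap => //; exact: h.
Qed.

Definition Exact n' n (f : mono n' n) (F : Exobj n) : Exobj n' :=
  exist _ _ (conj (Exact_nat f F) (Exact_mark f F)).

Lemma Exobj_eq n (F G : Exobj n) :
  (forall m s h, sval F m s h = sval G m s h) -> F = G.
Proof.
case: F => F pF; case: G => G pG /= e.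
have eFG : F = G.
  apply: functional_extensionality_dep => m.
  apply: functional_extensionality_dep => s.
  apply: functional_extensionality_dep => h; exact: e.
subst G; f_equal; apply: proof_irrelevance.
Qed.

Lemma Exact_id n (F : Exobj n) : Exact (idm n) F = F.
Proof.
apply: Exobj_eq => m s h /=; apply: Fext; apply: chain_eq => i.
rewrite /= ffunE; rewrite -[RHS]imset_id; apply: eq_imset => x; by rewrite ffunE.
Qed.

Lemma Exact_comp m n p (f : mono m n) (g : mono n p) (F : Exobj p) :
  Exact (cprecomp g f) F = Exact f (Exact g F).
Proof.
apply: Exobj_eq => q s h /=; apply: Fext; apply: chain_eq => i.
rewrite /= !ffunE -imset_comp; apply: eq_imset => x; by rewrite /= ffunE.
Qed.

Definition ExGen : sset := SSet Exact_id Exact_comp.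
End ExGen.

Lemma sub_le_map n' n (f : mono n' n) A B :
  sub_le A B -> sub_le (sval f @: A) (sval f @: B).
Proof. exact: imsetS. Qed.

Lemma sup_le_map n' n (f : mono n' n) A B :
  sup_le A B -> sup_le (sval f @: A) (sval f @: B).
Proof. exact: imsetS. Qed.

Lemma smax_char n (A : {set 'I_n.+1}) (a : 'I_n.+1) :
  a \in A -> (forall b, b \in A -> (b <= a)%N) -> smax A = a.
Proof.
move=> aA h; apply/eqP; rewrite eqn_leq; apply/andP; split.
  by apply/bigmax_leqP => i; exact: h.
by rewrite /smax (bigD1 a) //= leq_maxl.
Qed.

Lemma smin_char n (A : {set 'I_n.+1}) (a : 'I_n.+1) :
  a \in A -> (forall b, b \in A -> (a <= b)%N) -> smin A = a.
Proof.
move=> aA h; apply/eqP; rewrite eqn_leq; apply/andP; split.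
  rewrite /smin; move: (mem_index_enum a); elim: (index_enum _) => //= j s IH.
  rewrite inE big_cons; case/predU1P => [<-|ais]; first by rewrite aA geq_minl.
  by case: ifP => _; [rewrite geq_min IH ?orbT | exact: IH].
rewrite /smin; elim/big_ind: _ => //.
- exact: leq_ord.
- by move=> x y hx hy; rewrite leq_min hx hy.
Qed.

Lemma mono_le n' n (f : mono n' n) (i j : 'I_n'.+1) : (i <= j)%N -> (sval f i <= sval f j)%N.
Proof. by move=> hij; move/forallP: (svalP f) => /(_ i) /forallP /(_ j) /implyP; apply. Qed.

Lemma smax_img n' n (f : mono n' n) (A : {set 'I_n'.+1}) :
  A != set0 -> exists a, smax A = val a /\ smax (sval f @: A) = val (sval f a).
Proof.
case/set0Pn => x xA.
case: (@arg_maxnP _ x (mem A) (fun i : 'I_n'.+1 => val i) xA) => a aA ha.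
exists a; split; first exact: smax_char.
apply: smax_char; first exact: imset_f.
by move=> b /imsetP [c cA ->]; apply: mono_le; exact: ha.
Qed.

Lemma smin_img n' n (f : mono n' n) (A : {set 'I_n'.+1}) :
  A != set0 -> exists a, smin A = val a /\ smin (sval f @: A) = val (sval f a).
Proof.
case/set0Pn => x xA.
case: (@arg_minnP _ x (mem A) (fun i : 'I_n'.+1 => val i) xA) => a aA ha.
exists a; split; first exact: smin_char.
apply: smin_char; first exact: imset_f.
by move=> b /imsetP [c cA ->]; apply: mono_le; exact: ha.
Qed.

Lemma mark_max_map n' n (f : mono n' n) A B : A != set0 -> B != set0 ->
  mark_max A B -> mark_max (sval f @: A) (sval f @: B).
Proof.
move=> /(smax_img f) [a [ea fa]] /(smax_img f) [b [eb fb]].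
rewrite /mark_max ea eb fa fb => /eqP /val_inj -> //.
Qed.

Lemma mark_min_map n' n (f : mono n' n) A B : A != set0 -> B != set0 ->
  mark_min A B -> mark_min (sval f @: A) (sval f @: B).
Proof.
move=> /(smin_img f) [a [ea fa]] /(smin_img f) [b [eb fb]].
rewrite /mark_min ea eb fa fb => /eqP /val_inj -> //.
Qed.

Definition Ex_plus (X : msset) : sset :=
  @ExGen X sub_le mark_max sub_le_map mark_max_map.

Definition Ex_op_plus (X : msset) : sset :=
  @ExGen X sup_le mark_min sup_le_map mark_min_map.

(* Main.v *)
Require Import Defs.
From Stdlib Require Import FunctionalExtensionality ProofIrrelevance.
From mathcomp Require Import all_boot.
Set Implicit Arguments. Unset Strict Implicit. Unset Printing Implicit Defensive.

(** By adjunction, filling [horn k] in [Ex] amounts to extending marked maps from the chains of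
    nonempty subsets of [[n]] whose union misses some [j != k], i.e. which avoid [[n]] and
    [D = [n] \ k], to all chains of nonempty subsets.

    For 0 < k < n the inclusion LJ -> L is a retract of this one, by [A |-> k |: A]. For the extreme
    value of [k] all edges of L are marked, and the inclusion is a retract of the one for a horn
    of dimension n+1, the extra vertex being used to make edges marked.

    Conversely, a map given on the chains avoiding [[n]] and [D] is first extended, by the lifting
    property, to chains through [[n]] all of whose members contain [k]. A further chain [C]
    through [[n]] has a largest member [A] without [k]; inserting or removing [k |: A], which lies
    strictly between [A] and [[n]], pairs these chains into inner horns. The horn misses an edge only
    for the triangle [A, k |: A, [n]], where weak closure under composition provides the marking.
    Finally [D] is sent to the value at [[n]], which preserves markings because [k] is inner.

    Both orders are treated at once: [r] is inclusion or reverse inclusion, and an edge is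
    marked when a function ([smax] or [smin]) takes the same value at its ends. *)

(** * Chains of a relation and maps on subcomplexes of its nerve *)

Lemma idmE n i : sval (idm n) i = i.
Proof. by rewrite /= ffunE. Qed.

Lemma cprecompE (T : finType) (r : rel T) m n (s : chain r n) (t : mono m n) i :
  sval (cprecomp s t) i = sval s (sval t i).
Proof. by rewrite ffunE. Qed.

Section Chains.
Variables (T : finType) (r : rel T).

Lemma chain_le m (s : chain r m) (i j : 'I_m.+1) :
  (i <= j)%N -> r (sval s i) (sval s j).
Proof. by move=> hij; move/forallP: (svalP s) => /(_ i) /forallP /(_ j) /implyP; apply. Qed.

Lemma is_chain_finfun m (f : 'I_m.+1 -> T) :
  (forall i j : 'I_m.+1, (i <= j)%N -> r (f i) (f j)) -> is_chain r [ffun i => f i].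
Proof.
by move=> h; apply/forallP => i; apply/forallP => j; apply/implyP => ij; rewrite !ffunE h.
Qed.

Definition mkchain m (f : 'I_m.+1 -> T)
    (h : forall i j : 'I_m.+1, (i <= j)%N -> r (f i) (f j)) : chain r m :=
  exist (fun g => is_chain r g) [ffun i => f i] (is_chain_finfun h).

Lemma mkchainE m f h i : sval (@mkchain m f h) i = f i.
Proof. by rewrite ffunE. Qed.

Lemma cprecompA m n p (s : chain r p) (t : mono n p) (u : mono m n) :
  cprecomp (cprecomp s t) u = cprecomp s (cprecomp t u).
Proof. by apply: chain_eq => i; rewrite !cprecompE. Qed.

Definition img m (s : chain r m) : {set T} := [set sval s i | i : 'I_m.+1].

Lemma mem_img m (s : chain r m) i : sval s i \in img s.
Proof. exact: imset_f. Qed.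

Lemma img_precomp m n (s : chain r n) (t : mono m n) : img (cprecomp s t) \subset img s.
Proof. by apply/subsetP => x /imsetP [i _ ->]; rewrite cprecompE mem_img. Qed.

Lemma subnerve_map_eq (S : subnerve r) (X : nat -> Type) (F : forall m s, S m s -> X m)
    m s t h h' : s = t -> F m s h = F m t h'.
Proof. by move=> e; subst t; rewrite (bool_irrelevance h h'). Qed.

(** Equal simplices built in different ways are rarely convertible, so naturality is restated up to
    a propositional equality. *)
Lemma natural_eq (S : subnerve r) (X : sset) (F : forall m s, S m s -> X m) :
  natural F -> forall m n (t : mono m n) s u h h',
  u = cprecomp s t -> F m u h' = sact t (F n s h).
Proof. by move=> nF m n t s u h h' e; subst u; exact: nF. Qed.

End Chains.

(** * Retracts of marked lifting problems *)

Section Retract.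
Variables (T T' : finType) (r : rel T) (r' : rel T').

Definition cmap (f : T -> T') (hf : forall x y, r x y -> r' (f x) (f y)) m (s : chain r m) :
    chain r' m :=
  mkchain (fun i j ij => hf _ _ (chain_le s ij)).

Lemma cmapE f hf m (s : chain r m) i : sval (@cmap f hf m s) i = f (sval s i).
Proof. exact: mkchainE. Qed.

Lemma cmap_precomp f hf m n (s : chain r n) (t : mono m n) :
  @cmap f hf m (cprecomp s t) = cprecomp (cmap hf s) t.
Proof. by apply: chain_eq => i; rewrite !cmapE !cprecompE cmapE. Qed.

End Retract.

(** A problem on [S] is moved to [Q] along [g], and its solution is pulled back along [f]. Only on
    vertices of chains in [S] must [g] undo [f], so [f] may collapse vertices that occur in [S']
    alone. *)
Lemma mrlp_retract (T T' : finType) (r : rel T) (r' : rel T') (M : rel T) (M' : rel T')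
    (S S' : subnerve r) (Q Q' : subnerve r') (X : msset) (f : T -> T') (g : T' -> T)
    (hf : forall x y, r x y -> r' (f x) (f y)) (hg : forall x y, r' x y -> r (g x) (g y)) :
  (forall m s, S m s -> Q m (cmap hf s)) ->
  (forall m s, S' m s -> Q' m (cmap hf s)) ->
  (forall m s, Q m s -> S m (cmap hg s)) ->
  (forall m s, S m s -> forall i, g (f (sval s i)) = sval s i) ->
  (forall s : chain r 1, S' 1 s -> M (sval s ord0) (sval s ord_max) ->
     M' (f (sval s ord0)) (f (sval s ord_max))) ->
  (forall s : chain r' 1, Q 1 s -> M' (sval s ord0) (sval s ord_max) ->
     M (g (sval s ord0)) (g (sval s ord_max))) ->
  mrlp M' Q Q' X -> mrlp M S S' X.
Proof.
move=> fS fS' gQ gfK fM gM lift F nF mF.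
pose F' m s (h : Q m s) := F m (cmap hg s) (gQ m s h).
have nF' : natural F'.
  by move=> m n t s h h'; apply: (natural_eq nF); rewrite cmap_precomp.
have mF' : marked M' (@mW X) F'.
  by move=> e h hM; apply: mF; rewrite !cmapE; exact: gM.
case: (lift F' nF' mF') => G [nG [mG eG]].
exists (fun m s h => G m (cmap hf s) (fS' m s h)); split; [|split].
- by move=> m n t s h h'; apply: (natural_eq nG); rewrite cmap_precomp.
- by move=> e h hM; apply: mG; rewrite !cmapE; exact: fM.
- move=> m s h h'; rewrite (eG _ _ (fS m s h)); apply: (subnerve_map_eq F).
  by apply: chain_eq => i; rewrite !cmapE (gfK _ _ h).
Qed.

(** * Monotone retractions of [n] onto its subsets *)

Section Retraction.
Variables (n : nat) (A : {set 'I_n.+1}).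

(** Rounding up to the next element of [A]; the default [smax A] serves the [i] beyond all of
    [A]. *)
Definition rt_val (i : nat) : nat := \big[minn/smax A]_(a in A | (i <= a)%N) val a.

Lemma smax_ltn : (smax A < n.+1)%N.
Proof. by rewrite ltnS; apply/bigmax_leqP => i _; rewrite -ltnS ltn_ord. Qed.

Lemma rt_val_ltn i : (rt_val i < n.+1)%N.
Proof.
apply: (big_ind (fun x => (x < n.+1)%N)); first exact: smax_ltn.
  by move=> x y hx hy; rewrite gtn_min hx.
by move=> a _; exact: ltn_ord.
Qed.

Lemma rt_val_le i j : (i <= j)%N -> (rt_val i <= rt_val j)%N.
Proof.
move=> ij; rewrite /rt_val; elim: (index_enum _) => [|a s IH]; first by rewrite !big_nil.
rewrite !big_cons; case: (a \in A) => //=.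
case: (leqP j a) => ja; first by rewrite (leq_trans ij ja) leq_min geq_minl geq_min IH orbT.
by case: ifP => // _; rewrite geq_min IH orbT.
Qed.

(** For nonempty [A] this idempotent of [n] stands in for the inclusion of the face spanned by [A]:
    [A] need not be enumerated and the dimension stays [n]. *)
Definition rt : mono n n :=
  mkchain (f := fun i : 'I_n.+1 => inord (rt_val i))
   (fun i j ij => eq_ind_r (fun x => (x <= _)%N) (eq_ind_r (fun x => (_ <= x)%N)
       (rt_val_le ij) (inordK (rt_val_ltn j))) (inordK (rt_val_ltn i)) : @ord_le n _ _).

Lemma rt_id i : i \in A -> sval rt i = i.
Proof.
move=> iA; rewrite mkchainE; apply: val_inj; rewrite /= inordK ?rt_val_ltn //.
have ->: rt_val i = i; last by [].
apply/eqP; rewrite eqn_leq; apply/andP; split; last first.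
  rewrite /rt_val; apply: (big_ind (fun x => (i <= x)%N)).
  - by rewrite /smax (bigD1 i) //= leq_maxl.
  - by move=> x y hx hy; rewrite leq_min hx.
  - by move=> a /andP [].
rewrite /rt_val; move: (mem_index_enum i); elim: (index_enum _) => //= j s IH.
rewrite inE big_cons; case/predU1P => [<-|ais]; first by rewrite iA leqnn geq_minl.
by case: ifP => _; [rewrite geq_min IH ?orbT | exact: IH].
Qed.

Lemma rt_mem i : A != set0 -> sval rt i \in A.
Proof.
move=> /set0Pn [a0 a0A]; rewrite mkchainE /rt_val.
apply: (big_ind (fun x => inord x \in A)).
(* The default value is in [A] because a nonempty set attains its maximum. *)
- have [|a aA e] := @eq_bigmax_cond _ (mem A) (fun a : 'I_n.+1 => val a).
    by apply/card_gt0P; exists a0.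
  by rewrite (_ : smax A = a) ?inord_val.
- by move=> x y hx hy; rewrite /minn; case: ifP.
- by move=> a /andP [aA _]; rewrite inord_val.
Qed.

End Retraction.

(** * The two adjoint forms of a horn filling problem *)

(** This is the subdivision of the horn, the union of the subdivisions of the faces opposite to the
    [j != k]. *)
Definition sdhorn n (k : 'I_n.+1) (r : rel {set 'I_n.+1}) : subnerve r :=
  fun m s => sdsub r s && [exists j, (j != k) && [forall i, j \notin sval s i]].

Section Transpose.
Variables (X : msset) (r M : forall n, rel {set 'I_n.+1}).
Arguments r {n}. Arguments M {n}.
Hypothesis rmap : forall n' n (f : mono n' n) A B,
  r A B -> r (sval f @: A) (sval f @: B).
Hypothesis Mmap : forall n' n (f : mono n' n) A B, A != set0 -> B != set0 ->
  M A B -> M (sval f @: A) (sval f @: B).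
Variables (n : nat) (k : 'I_n.+1).

Let Ex := ExGen X rmap Mmap.

(** Spans the smallest face of [n] whose subdivision contains the chain. *)
Definition supp m (s : chain (@r n) m) : {set 'I_n.+1} := \bigcup_i sval s i.

Lemma sub_supp m (s : chain (@r n) m) i : sval s i \subset supp s.
Proof. exact: bigcup_sup. Qed.

Lemma pushcE p q (f : mono p q) m (s : chain (@r p) m) i :
  sval (pushc rmap f s) i = sval f @: sval s i.
Proof. by rewrite /= ffunE. Qed.

Lemma push_rt (A : {set 'I_n.+1}) m (s : chain (@r n) m) :
  (forall i, sval s i \subset A) -> pushc rmap (rt A) s = s.
Proof.
move=> sA; apply: chain_eq => i; rewrite pushcE -[RHS]imset_id.
by apply: eq_in_imset => x /(subsetP (sA i)); exact: rt_id.
Qed.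

Lemma push_precomp p q (f : mono p q) m l (s : chain (@r p) m) (t : mono l m) :
  pushc rmap f (cprecomp s t) = cprecomp (pushc rmap f s) t.
Proof. by apply: chain_eq => i; rewrite pushcE !cprecompE pushcE. Qed.

Lemma sdhorn_sd m (s : chain (@r n) m) : sdhorn k s -> sdsub (@r n) s.
Proof. by case/andP. Qed.

Lemma rt_horn m (s : chain (@r n) m) : sdhorn k s -> horn k (rt (supp s)).
Proof.
case/andP=> /forallP s0 /existsP [j /andP [jk /forallP js]].
apply/existsP; exists j; rewrite jk /=; apply/forallP => i.
have : sval (rt (supp s)) i \in supp s.
  apply: rt_mem; case/set0Pn: (s0 ord0) => x xs.
  by apply/set0Pn; exists x; exact: (subsetP (sub_supp s ord0)).
by apply: contraL => /eqP ->; apply/bigcupP => -[i' _]; apply/negP; exact: js.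
Qed.

Lemma push_sdhorn p (f : mono p n) m (s : chain (@r p) m) :
  horn k f -> sdsub (@r p) s -> sdhorn k (pushc rmap f s).
Proof.
case/existsP=> j /andP [jk /forallP fj] hs; rewrite /sdhorn push_sd //=.
apply/existsP; exists j; rewrite jk /=; apply/forallP => i.
by rewrite pushcE; apply/imsetP => -[x _ e]; move: (fj x); rewrite -e eqxx.
Qed.

(** A chain of [sdhorn] is evaluated by [F] at the retraction onto its support, which is a simplex
    of the horn. An extension [G] to all chains of nonempty subsets is an [n]-simplex of Ex, whose
    restrictions fill the horn. *)
Lemma Ex_mrlp_rlp :
  mrlp (@M n) (@sdhorn n k r) (@sdsub n r) X -> rlp (horn k) (@full _ (@ord_le n)) Ex.
Proof.
move=> lift F nF.
pose Fh m s (h : @sdhorn n k r m s) := sval (F n (rt (supp s)) (rt_horn h)) m s (sdhorn_sd h).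
(* Values of [F] depend only on the pushed chain: both sides are restrictions of [F] at the
   retraction onto [B], the image of [f]. *)
have key p (f : mono p n) hf m (s' : chain (@r p) m) hs s h : pushc rmap f s' = s ->
    sval (F p f hf) m s' hs = Fh m s h.
  move=> es; pose B := img f.
  have [j /andP [jk /forallP fj]] := existsP hf.
  have B0 : B != set0 by apply/set0Pn; exists (sval f ord0); exact: mem_img.
  have hB : horn k (rt B).
    apply/existsP; exists j; rewrite jk /=; apply/forallP => i.
    apply/eqP => e; have := rt_mem i B0; rewrite e => /imsetP [x _ e'].
    by move: (fj x); rewrite -e' eqxx.
  have sB i : sval s i \subset B.
    rewrite -es pushcE; apply/subsetP => x /imsetP [y _ ->]; exact: mem_img.
  have -> : F p f hf = Exact rmap Mmap f (F n (rt B) hB).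
    apply: (natural_eq (X := Ex) nF); apply: chain_eq => i.
    by rewrite cprecompE rt_id // mem_img.
  have eFs : F n (rt (supp s)) (rt_horn h) = Exact rmap Mmap (rt (supp s)) (F n (rt B) hB).
    apply: (natural_eq (X := Ex) nF); apply: chain_eq => i.
    rewrite cprecompE [RHS]rt_id //; apply: (subsetP (_ : supp s \subset B)).
      by apply/bigcupsP.
    apply: rt_mem; case/set0Pn: (forallP (sdhorn_sd h) ord0) => x xs.
    by apply/set0Pn; exists x; exact: (subsetP (sub_supp s ord0)).
  rewrite /Fh eFs /=; apply: Fext; rewrite es push_rt //.
  exact: sub_supp.
have nFh : natural Fh.
  move=> m p t s h h'.
  have hs : sdsub (@r n) (cprecomp s t) := sdhorn_sd h'.
  rewrite -(key _ (rt (supp s)) (rt_horn h) _ (cprecomp s t) hs); last first.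
    by apply: push_rt => i; rewrite cprecompE sub_supp.
  exact: (proj1 (svalP (F n (rt (supp s)) (rt_horn h)))).
have mFh : marked (@M n) (@mW X) Fh.
  by move=> e h; exact: (proj2 (svalP (F n (rt (supp e)) (rt_horn h)))).
have [G [nG [mG eG]]] := lift Fh nFh mFh.
pose g : Exobj X (@r) (@M) n := exist _ G (conj nG mG).
exists (fun m f _ => Exact rmap Mmap f g); split.
  move=> m p t s h h'; exact: (sact_comp (s := Ex)).
move=> m f h h'; apply: Exobj_eq => p s hs /=.
by rewrite (eG _ _ (push_sdhorn h hs)) -(key _ _ h _ _ hs).
Qed.

(** The filler is read at [idm n]. On a chain [s] of [sdhorn] it is compared with [F] through
    [rt (supp s)], a simplex of the horn that fixes [s]. *)
Lemma Ex_rlp_mrlp :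
  rlp (horn k) (@full _ (@ord_le n)) Ex -> mrlp (@M n) (@sdhorn n k r) (@sdsub n r) X.
Proof.
move=> lift F nF mF.
have nf p (f : mono p n) (h : horn k f) :
    natural (fun m s (hs : sdsub (@r p) s) => F m (pushc rmap f s) (push_sdhorn h hs)).
  by move=> m q t s hs hs'; apply: (natural_eq nF); exact: push_precomp.
have mf p (f : mono p n) (h : horn k f) : marked (@M p) (@mW X)
    (fun m s (hs : sdsub (@r p) s) => F m (pushc rmap f s) (push_sdhorn h hs)).
  by move=> e hs hM; apply: mF; rewrite !pushcE; apply: Mmap hM; exact: (forallP hs).
pose Ft p f h : Ex p := exist _ _ (conj (nf p f h) (mf p f h)).
have nFt : natural Ft.
  move=> m p t s h h'; apply: Exobj_eq => q u hu /=.
  apply: (subnerve_map_eq F); apply: chain_eq => i.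
  by rewrite !pushcE -imset_comp; apply: eq_imset => x; rewrite cprecompE.
have [G [nG eG]] := lift Ft nFt.
exists (fun m s h => sval (G n (idm n) isT) m s h); split; [|split].
- exact: (proj1 (svalP (G n (idm n) isT))).
- exact: (proj2 (svalP (G n (idm n) isT))).
move=> m s h h'.
have sK : pushc rmap (rt (supp s)) s = s by apply: push_rt => i; exact: sub_supp.
have e1 : G n (rt (supp s)) isT = Exact rmap Mmap (rt (supp s)) (G n (idm n) isT).
  apply: (natural_eq (X := Ex) nG); apply: chain_eq => i.
  by rewrite cprecompE idmE.
have e2 := eG _ _ (rt_horn h) isT.
transitivity (sval (G n (rt (supp s)) isT) m s h').
  by rewrite e1; apply: Fext; rewrite sK.
by rewrite e2; apply: (subnerve_map_eq F); rewrite sK.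
Qed.

End Transpose.

(** * Lifting against L and R from inner horns *)

Definition incl_or_rev (r : forall n, rel {set 'I_n.+1}) : Prop :=
  (forall n A B, r n A B = (A \subset B)) \/ (forall n A B, r n A B = (B \subset A)).

Section Inclusion.
Variables (X : msset) (r M : forall n, rel {set 'I_n.+1}).
Arguments r {n}. Arguments M {n}.
Hypothesis hr : incl_or_rev (@r).

Lemma incl_homo n p (f : {set 'I_n.+1} -> {set 'I_p.+1}) :
  (forall A B : {set 'I_n.+1}, A \subset B -> f A \subset f B) -> forall A B, r A B -> r (f A) (f B).
Proof. by case: hr => e hf A B; rewrite !e => /hf. Qed.

Lemma chain_top n m (s : chain (@r n) m) : exists t, forall i, sval s i \subset sval s t.
Proof.
case: hr => e; [exists ord_max | exists ord0] => i; rewrite -(e n); apply: chain_le => //.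
exact: leq_ord.
Qed.

(** The retract criterion in terms of subsets. As a chain has a largest member, an element missing
    from [f] of that member is missing from the whole image chain. *)
Lemma sd_L_lifting n p (k : 'I_n.+1) (l : 'I_p.+1)
    (f : {set 'I_n.+1} -> {set 'I_p.+1}) (g : {set 'I_p.+1} -> {set 'I_n.+1}) :
  (forall A B : {set 'I_n.+1}, A \subset B -> f A \subset f B) ->
  (forall A B : {set 'I_p.+1}, A \subset B -> g A \subset g B) ->
  (forall A : {set 'I_n.+1}, k \in A -> g (f A) = A) ->
  (forall A : {set 'I_n.+1}, k \in A -> f A != set0) ->
  (forall B : {set 'I_p.+1}, B != set0 -> k \in g B) ->
  (forall A : {set 'I_n.+1}, k \in A -> A != setT -> exists2 j, j != l & j \notin f A) ->
  (forall (B : {set 'I_p.+1}) j, j != l -> j \notin B -> g B != setT) ->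
  (forall A B : {set 'I_n.+1}, k \in A -> k \in B -> M A B -> M (f A) (f B)) ->
  (forall A B : {set 'I_p.+1}, A != set0 -> B != set0 -> M A B -> M (g A) (g B)) ->
  mrlp (@M p) (@sdhorn p l r) (@sdsub p r) X ->
  mrlp (@M n) (@LJsub n k r) (@Lsub n k r) X.
Proof.
move=> hf hg gfK f0 gk fl gl fM gM.
apply: (mrlp_retract (hf := incl_homo hf) (hg := incl_homo hg)).
- move=> m s /forallP hs; apply/andP; split.
    by apply/forallP => i; rewrite cmapE; apply: f0; case/andP: (hs i).
  have [t st] := chain_top s; have /andP [kt tT] := hs t.
  have [j jl jt] := fl _ kt tT.
  apply/existsP; exists j; rewrite jl; apply/forallP => i; rewrite cmapE.
  by apply: contra jt; apply: (subsetP (hf _ _ (st i))).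
- by move=> m s /forallP hs; apply/forallP => i; rewrite cmapE; apply: f0.
- move=> m s /andP [/forallP s0 /existsP [j /andP [jl /forallP js]]].
  by apply/forallP => i; rewrite cmapE gk ?s0 //=; exact: gl jl (js i).
- by move=> m s /forallP hs i; apply: gfK; case/andP: (hs i).
- by move=> s /forallP hs hM; apply: fM hM; apply: hs.
- by move=> s /andP [/forallP hs _] hM; apply: gM hM; apply: hs.
Qed.

(** A set containing [k] is proper exactly when it misses some [j != k], and adding [k] to a set
    keeps such a [j] missing. *)
Lemma sd_L_lifting_add n (k : 'I_n.+1) :
  (forall A B : {set 'I_n.+1}, A != set0 -> B != set0 -> M A B -> M (k |: A) (k |: B)) ->
  mrlp (@M n) (@sdhorn n k r) (@sdsub n r) X ->
  mrlp (@M n) (@LJsub n k r) (@Lsub n k r) X.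
Proof.
move=> hM; apply: (sd_L_lifting (f := id) (g := fun A => k |: A)) => //.
- by move=> A B; exact: setUS.
- by move=> A kA; apply/setUidPr; rewrite sub1set.
- by move=> A kA; apply/set0Pn; exists k.
- by move=> B _; rewrite setU11.
- move=> A kA; rewrite -subTset => /subsetPn [j _ jA]; exists j => //.
  by apply: contraNneq jA => ->.
- move=> B j jk jB; apply/eqP => /setP /(_ j).
  by rewrite !inE (negbTE jk) (negbTE jB).
Qed.

(* The vertex [x] of [n+1] outside the image of [lift x] is put in every set [f A]: this makes
   all the edges [f A -> f B] marked when [x] is extremal, while sets without [x] can be
   retracted to the vertex [{k}]. *)
Lemma sd_L_lifting_lift n (k : 'I_n.+1) (x : 'I_n.+2) : (0 < n)%N ->
  (forall A B : {set 'I_n.+1}, k \in A -> k \in B -> M A B) ->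
  (forall A B : {set 'I_n.+2}, x \in A -> x \in B -> M A B) ->
  mrlp (@M n.+1) (@sdhorn n.+1 (lift x k) r) (@sdsub n.+1 r) X ->
  mrlp (@M n) (@LJsub n k r) (@Lsub n k r) X.
Proof.
move=> n0 Mk Mx.
pose f (A : {set 'I_n.+1}) := x |: (lift x @: A).
pose g (B : {set 'I_n.+2}) := [set j | (j == k) || (x \in B) && (lift x j \in B)].
have memf A j : (lift x j \in f A) = (j \in A).
  by rewrite !inE eq_sym (negbTE (neq_lift _ _)) /= mem_imset //; exact: lift_inj.
apply: (sd_L_lifting (f := f) (g := g)).
- by move=> A B AB; apply: setUS; apply: imsetS.
- move=> A B AB; apply/subsetP => j; rewrite !inE.
  by case: eqP => //= _ /andP [/(subsetP AB) -> /(subsetP AB) ->].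
- by move=> A kA; apply/setP => j; rewrite inE memf setU11 /=; case: eqP => // ->.
- by move=> A _; apply/set0Pn; exists x; rewrite setU11.
- by move=> B _; rewrite inE eqxx.
- move=> A kA; rewrite -subTset => /subsetPn [j _ jA]; exists (lift x j); last by rewrite memf.
  by apply: contraNneq jA => /lift_inj ->.
- move=> B j jk jB; apply/eqP => gT; case: (unliftP x j) => [i|] ej.
    move/setP/(_ i): gT; rewrite !inE -ej (negbTE jB) andbF orbF => /eqP ik.
    by rewrite ej ik eqxx in jk.
  (* Now [j] is [x], so [g B] is the singleton of [k], which is proper since [0 < n]. *)
  have [i ik] : exists i : 'I_n.+1, i != k.
    case: (eqVneq k ord0) => [->|k0]; last by exists ord0; rewrite eq_sym.
    by exists ord_max; rewrite -val_eqE /= -lt0n.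
  by move/setP/(_ i): gT; rewrite !inE -ej (negbTE jB) (negbTE ik).
- by move=> A B _ _ _; apply: Mx; rewrite setU11.
- by move=> A B _ _ _; apply: Mk; rewrite inE eqxx.
Qed.

End Inclusion.

(** * Maxima and minima of subsets *)

Lemma leq_smax n (A : {set 'I_n.+1}) i : i \in A -> (i <= smax A)%N.
Proof. by move=> iA; rewrite /smax (bigD1 i) //= leq_maxl. Qed.

Lemma smin_leq n (A : {set 'I_n.+1}) i : i \in A -> (smin A <= i)%N.
Proof.
move=> iA; rewrite /smin; move: (mem_index_enum i); elim: (index_enum _) => //= j s IH.
rewrite inE big_cons; case/predU1P => [<-|ais]; first by rewrite iA geq_minl.
by case: ifP => _; [rewrite geq_min IH ?orbT | exact: IH].
Qed.

(** The bound on [x] is for the empty set, whose [smin] is the default value [n]. *)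
Lemma leq_smin n (A : {set 'I_n.+1}) x :
  (x <= n)%N -> (forall i, i \in A -> (x <= i)%N) -> (x <= smin A)%N.
Proof.
move=> xn h; apply: (big_ind (fun y => (x <= y)%N)) => //.
by move=> y z hy hz; rewrite leq_min hy.
Qed.

Lemma smin_leqn n (A : {set 'I_n.+1}) : (smin A <= n)%N.
Proof.
apply: (big_ind (fun y => (y <= n)%N)) => [//|y z hy _|i _]; last exact: leq_ord.
by rewrite geq_min hy.
Qed.

Lemma smaxU1 n (k : 'I_n.+1) A : smax (k |: A) = maxn k (smax A).
Proof.
apply/eqP; rewrite eqn_leq geq_max leq_smax ?setU11 //=; apply/andP; split.
  apply/bigmax_leqP => i /setU1P [->|iA]; first exact: leq_maxl.
  by rewrite leq_max leq_smax ?orbT.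
by apply/bigmax_leqP => i iA; rewrite leq_smax // setU1r.
Qed.

Lemma sminU1 n (k : 'I_n.+1) A : smin (k |: A) = minn k (smin A).
Proof.
apply/eqP; rewrite eqn_leq leq_min smin_leq ?setU11 //=; apply/andP; split.
  by apply: leq_smin => [|i iA]; [exact: smin_leqn | rewrite smin_leq // setU1r].
apply: leq_smin => [|i /setU1P [->|iA]]; first by rewrite geq_min leq_ord.
  exact: geq_minl.
by rewrite geq_min smin_leq ?orbT.
Qed.

(** * From fillers in Ex to the L and R liftings *)

Lemma Ex_plus_L_lifting (X : msset) : is_quasicat (Ex_plus X) -> L_lifting X.
Proof.
move=> qX n k n2 /andP [k0 _]; have hr : incl_or_rev (@sub_le) by left.
have [kn|] := ltnP k n.
  apply: (sd_L_lifting_add (r := @sub_le) (M := @mark_max) hr).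
    by move=> A B _ _; rewrite /mark_max !smaxU1 => /eqP ->.
  by apply: (Ex_rlp_mrlp (rmap := sub_le_map) (Mmap := mark_max_map)); apply: qX; rewrite k0.
move=> nk; have -> : k = ord_max by apply: val_inj; apply/eqP; rewrite eqn_leq leq_ord.
have maxT p (A B : {set 'I_p.+1}) : ord_max \in A -> ord_max \in B -> mark_max A B.
  by move=> mA mB; rewrite /mark_max !(@smax_char _ _ ord_max) // => i; rewrite leq_ord.
apply: (sd_L_lifting_lift (x := ord_max) (r := @sub_le) (M := @mark_max) hr).
- exact: ltnW.
- exact: maxT.
- exact: maxT.
- apply: (Ex_rlp_mrlp (rmap := sub_le_map) (Mmap := mark_max_map)); apply: qX.
  (* The lifted vertex is [n] in [n+1], hence inner. *)
  by rewrite lift_max /= ltnSn andbT ltnW.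
Qed.

Lemma Ex_op_plus_R_lifting (X : msset) : is_quasicat (Ex_op_plus X) -> R_lifting X.
Proof.
move=> qX n k n2 kn; have hr : incl_or_rev (@sup_le) by right.
have [->|k0] := eqVneq k ord0; last first.
  apply: (sd_L_lifting_add (r := @sup_le) (M := @mark_min) hr).
    by move=> A B _ _; rewrite /mark_min !sminU1 => /eqP ->.
  by apply: (Ex_rlp_mrlp (rmap := sup_le_map) (Mmap := mark_min_map)); apply: qX; rewrite kn andbT lt0n.
have min0 p (A B : {set 'I_p.+1}) : ord0 \in A -> ord0 \in B -> mark_min A B.
  by move=> mA mB; rewrite /mark_min !(@smin_char _ _ ord0).
apply: (sd_L_lifting_lift (x := ord0) (r := @sup_le) (M := @mark_min) hr).
- exact: ltnW.
- exact: min0.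
- exact: min0.
- apply: (Ex_rlp_mrlp (rmap := sup_le_map) (Mmap := mark_min_map)); apply: qX.
  (* The lifted vertex is [1] in [n+1], inner because [n] is positive. *)
  by rewrite lift0 /= ltnS ltnW.
Qed.

(** * Attaching an inner horn to a subcomplex of a nerve *)

(** An edge outside the horn meets every vertex other than [k]; these include [0] and [p], and would
    include a third one if [p >= 3]. *)
Lemma edge_in_horn p (k : 'I_p.+1) (c : mono 1 p) : (0 < k < p)%N -> ~~ horn k c ->
  [/\ p = 2, sval c ord0 = ord0 & sval c ord_max = ord_max].
Proof.
move=> /andP [k0 kp] /existsPn hc.
have onc j : j != k -> (j == sval c ord0) || (j == sval c ord_max).
  move=> jk; have := hc j; rewrite jk /= => /forallPn [i]; rewrite negbK => /eqP <-.
  have /orP [] : (i == ord0) || (i == ord_max) by case: i => -[|[|]].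
    by move=> /eqP ->; rewrite eqxx.
  by move=> /eqP ->; rewrite eqxx orbT.
have c01 : (sval c ord0 <= sval c ord_max)%N by apply: (chain_le c).
have /orP h0 : (ord0 == sval c ord0) || (ord0 == sval c ord_max).
  by apply: onc; rewrite -val_eqE /= eq_sym -lt0n.
have /orP hp : (ord_max == sval c ord0) || (ord_max == sval c ord_max).
  by apply: onc; rewrite -val_eqE /= eq_sym neq_ltn kp.
have p0 : (0 < p)%N := leq_ltn_trans (leq0n _) kp.
have e0 : sval c ord0 = ord0.
  case: h0 => /eqP e; first by rewrite -e.
  by apply: val_inj; apply/eqP; rewrite -leqn0 (leq_trans c01) // -e.
have e1 : sval c ord_max = ord_max.
  case: hp => /eqP e; last by rewrite -e.
  by exfalso; move: p0; rewrite e0 in e; move/(congr1 val): e => /= ->.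
split=> //; apply/eqP; rewrite eqn_leq (leq_ltn_trans k0 kp) andbT leqNgt; apply/negP => p3.
(* For [p >= 3] this vertex differs from [0], [k] and [p]. *)
pose j : 'I_p.+1 := inord (if val k == 1 then 2 else 1).
have vj : val j = if val k == 1 then 2 else 1.
  by rewrite /= inordK //; case: ifP => _; rewrite ltnS; [exact: ltnW | exact: p0].
have := onc j; rewrite e0 e1 -!val_eqE vj /=.
case: (eqVneq (val k) 1) => [->|k1] /=.
  by move=> /(_ isT) /eqP p2; rewrite -p2 in p3.
by rewrite eq_sym k1 => /(_ isT) /eqP p2; rewrite -p2 in p3.
Qed.

(* Only for [p = 2] does the horn miss an edge; it is then marked only if all edges are. *)
Lemma inner_horn_mrlp (X : msset) : is_quasicat X -> weakly_closed X ->
  forall p (k : 'I_p.+1) (N : rel 'I_p.+1), (0 < k < p)%N ->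
  (N ord0 ord_max -> forall i j : 'I_p.+1, (i <= j)%N -> N i j) ->
  mrlp N (horn k) (@full _ (@ord_le p)) X.
Proof.
move=> qX wX p k N kp hN F nF mF.
have [/andP [/eqP p2 /hN NT]|nNT] := boolP ((p == 2) && N ord0 ord_max).
  subst p; have ek : k = inord 1.
    by apply: val_inj; rewrite /= inordK //; case: k kp {F nF mF} => -[|[|]].
  subst k; have mF' : marked (fun _ _ => true) (@mW X) F.
    by move=> e h _; apply: mF; apply: NT; apply: (chain_le e).
  have [G [nG [mG eG]]] := wX F nF mF'.
  by exists G; split=> //; split=> // e h _; apply: mG.
have [G [nG eG]] := qX p k kp F nF.
exists G; split=> //; split=> // c h hc.
(* A marked edge outside the horn would be the long edge of a triangle, against [nNT]. *)
have [hk|/edge_in_horn [] // p2 e0 e1] := boolP (horn k c).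
  by rewrite (eG _ _ hk); apply: mF.
by case/negP: nNT; rewrite -e0 -e1 hc p2.
Qed.

Section Attach.
Variables (T : finType) (r M : rel T) (X : msset).
Hypotheses (r_refl : reflexive r) (r_trans : transitive r) (r_anti : antisymmetric r).

(** Simplices are selected by their vertex sets, so that subcomplexes become finite sets and cells
    are attached by unions. *)
Definition nerve_of (K : {set {set T}}) : subnerve r := fun m s => img s \in K.

Lemma enum_chain (tau : {set T}) p : #|tau| = p.+1 -> {in tau &, total r} ->
  exists2 e : chain r p, injective (sval e) & img e = tau.
Proof.
move=> cp tot; have /card_gt0P [x0 _] : (0 < #|tau|)%N by rewrite cp.
pose l := sort r (enum tau).
have sl : size l = p.+1 by rewrite size_sort -cardE.
have srt : sorted r l.
  by apply: (sort_sorted_in (P := mem tau)) => //; apply/allP => x; rewrite mem_enum.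
have ul : uniq l by rewrite sort_uniq enum_uniq.
have hl i j : (i <= j < p.+1)%N -> r (nth x0 l i) (nth x0 l j).
  move=> /andP [ij jp].
  by apply: (sorted_leq_nth r_trans r_refl) => //; rewrite inE sl // (leq_ltn_trans ij).
exists (@mkchain _ r p (fun i => nth x0 l i)
  (fun i j ij => hl i j (introT andP (conj ij (ltn_ord j))))).
  move=> i j; rewrite !mkchainE => /eqP; rewrite nth_uniq ?sl // => /eqP; exact: val_inj.
apply/setP => x; rewrite -(mem_enum tau) -(mem_sort r); apply/imsetP/idP => [[i _ ->]|].
  by rewrite mkchainE mem_nth ?sl.
move=> /(nthP x0) [i]; rewrite sl => ip <-.
by exists (Ordinal ip); rewrite ?mkchainE.
Qed.

(** The simplex on [tau] meets [K] exactly in the horn at [v], which [u] and [w] make inner, so the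
    new complex is a pushout along that horn. The last hypothesis spreads a marking of the long edge
    to every edge, as [inner_horn_mrlp] requires. *)
Lemma attach_inner_cell (K : {set {set T}}) (tau : {set T}) (v : T) :
  is_quasicat X -> weakly_closed X ->
  (forall C C' : {set T}, C \subset C' -> C' \in K -> C \in K) ->
  {in tau &, total r} -> v \in tau ->
  (exists2 u, u \in tau & (u != v) && r u v) ->
  (exists2 w, w \in tau & (w != v) && r v w) ->
  tau :\ v \notin K ->
  (forall w, w \in tau -> w != v -> tau :\ w \in K) ->
  (forall a b c d, a \in tau -> d \in tau -> r a b -> r b c -> r c d -> M a d -> M b c) ->
  mrlp M (nerve_of K) (nerve_of (K :|: [set tau; tau :\ v])) X.
Proof.
move=> qX wX Kdown tot vt [u ut /andP [uv ruv]] [w wt /andP [wv rvw]] nK Kface hM F nF mF.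
have cp : #|tau| = #|tau|.-1.+1 by rewrite prednK //; apply/card_gt0P; exists v.
move: (#|tau|.-1) cp => p cp.
have [e einj eimg] := enum_chain cp tot.
have emem i : sval e i \in tau by rewrite -eimg mem_img.
have eonto x : x \in tau -> exists i, x = sval e i.
  by rewrite -eimg => /imsetP [i _ ->]; exists i.
have ele i j : r (sval e i) (sval e j) -> (i <= j)%N.
  move=> rij; rewrite leqNgt; apply/negP => ji.
  have eij : sval e i = sval e j by apply: r_anti; rewrite rij (chain_le e) // ltnW.
  by rewrite (einj _ _ eij) ltnn in ji.
have [k ek] := eonto v vt.
have kp : (0 < k < p)%N.
  have [i ei] := eonto u ut; have [j ej] := eonto w wt.
  have ik : (i < k)%N.
    rewrite ltn_neqAle ele -?ei -?ek // andbT; apply: contra uv => /eqP/val_inj ik.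
    by rewrite ei ek ik.
  have kj : (k < j)%N.
    rewrite ltn_neqAle ele -?ej -?ek // andbT; apply: contra wv => /eqP/val_inj kj.
    by rewrite ej ek kj.
  by rewrite (leq_ltn_trans _ ik) // (leq_trans kj) // leq_ord.
pose N : rel 'I_p.+1 := fun i j => M (sval e i) (sval e j).
have hN : N ord0 ord_max -> forall i j : 'I_p.+1, (i <= j)%N -> N i j.
  move=> N0 i j ij; apply: (hM (sval e ord0) _ _ (sval e ord_max)) => //; try exact: (chain_le e).
  by apply: (chain_le e); exact: leq_ord.
(* This claim and the next identify the simplices of [tau] lying in [K] with the horn at [k]. *)
have hornK m (t : mono m p) : horn k t -> nerve_of K (cprecomp e t).
  case/existsP=> j /andP [jk /forallP tj].
  apply: (Kdown _ (tau :\ sval e j)).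
    apply/subsetP => x /imsetP [i _ ->]; rewrite cprecompE !inE emem andbT.
    by apply: contra (tj i) => /eqP /einj ->.
  by apply: Kface => //; apply: contra jk; rewrite ek => /eqP /einj ->.
have Khorn m (t : mono m p) : nerve_of K (cprecomp e t) -> horn k t.
  move=> hK; apply: contraR nK => /existsPn nh; apply: Kdown hK.
  apply/subsetP => x /setD1P [xv /eonto [j ej]]; subst x.
  have jk : j != k by apply: contra xv => /eqP ->; rewrite ek.
  have := nh j; rewrite jk /= => /forallPn [i]; rewrite negbK => /eqP <-.
  by rewrite -cprecompE mem_img.
pose Fh m (t : mono m p) (h : horn k t) := F m (cprecomp e t) (hornK m t h).
have nFh : natural Fh.
  by move=> m n t s h h'; apply: (natural_eq nF); rewrite cprecompA.
have mFh : marked N (@mW X) Fh.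
  by move=> c h hc; apply: mF; rewrite !cprecompE.
have [H [nH [mH eH]]] := inner_horn_mrlp qX wX kp hN nFh mFh.
pose x0 := H p (idm p) isT.
have HE m (t : mono m p) : H m t isT = sact t x0.
  by apply: (natural_eq nH); apply: chain_eq => i; rewrite cprecompE idmE.
pose inv x : 'I_p.+1 := odflt ord0 [pick j | sval e j == x].
have invK i : inv (sval e i) = i.
  rewrite /inv; case: pickP => [j /eqP /einj -> //|/(_ i)]; by rewrite eqxx.
have posle m (s : chain r m) (hs : img s \subset tau) (i j : 'I_m.+1) :
    (i <= j)%N -> ord_le (inv (sval s i)) (inv (sval s j)).
  move=> ij; have rij := chain_le s ij.
  have [i' ei] := eonto _ (subsetP hs _ (mem_img s i)).
  have [j' ej] := eonto _ (subsetP hs _ (mem_img s j)).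
  by rewrite ei ej !invK; apply: ele; rewrite -ei -ej.
pose pos m s hs : mono m p := mkchain (posle m s hs).
have posK m (s : chain r m) hs : cprecomp e (pos m s hs) = s.
  apply: chain_eq => i; rewrite cprecompE mkchainE.
  by have [j ->] := eonto _ (subsetP hs _ (mem_img s i)); rewrite invK.
have K'tau m (s : chain r m) : nerve_of (K :|: [set tau; tau :\ v]) s ->
    ~~ nerve_of K s -> img s \subset tau.
  rewrite /nerve_of !inE => /orP [->//|/orP [] /eqP -> _ //].
  exact: subsetDl.
pose G m (s : chain r m) (h : nerve_of (K :|: [set tau; tau :\ v]) s) : X m :=
  match boolP (nerve_of K s) with
  | AltTrue hK => F m s hK
  | AltFalse hK => sact (pos m s (K'tau m s h hK)) x0
  end.
have G_K m s h hK : G m s h = F m s hK.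
  rewrite /G; case: {-}_ / boolP => hK'; first by rewrite (bool_irrelevance hK' hK).
  by case/negP: (hK').
(* On simplices of [tau] both branches are restrictions of the filler [x0]; this gives naturality
   when a face drops into [K]. *)
have G_e m s h t : s = cprecomp e t -> G m s h = sact t x0.
  move=> es; have [hK|hK] := boolP (nerve_of K s).
    rewrite (G_K _ _ _ hK); have ht : horn k t by apply: Khorn; rewrite -es.
    by rewrite -HE (eH _ _ ht); apply: (subnerve_map_eq F).
  rewrite /G; case: {-}_ / boolP => hK'; first by case/negP: hK.
  congr sact; apply: chain_eq => i; rewrite mkchainE.
  by rewrite {1}es cprecompE invK.
exists G; split; [|split].
- move=> m n t s h h'; have [hK|hK] := boolP (nerve_of K s).
    have hK' : nerve_of K (cprecomp s t) by apply: Kdown hK; exact: img_precomp.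
    by rewrite (G_K _ _ _ hK) (G_K _ _ _ hK'); apply: nF.
  have es := posK _ _ (K'tau _ _ h hK).
  rewrite (G_e _ _ h _ (esym es)) -sact_comp; apply: G_e.
  by rewrite -{1}es cprecompA.
- move=> c h hc; have [hK|hK] := boolP (nerve_of K c).
    by rewrite (G_K _ _ _ hK); apply: mF.
  have es := posK _ _ (K'tau _ _ h hK).
  rewrite (G_e _ _ h _ (esym es)) -HE; apply: mH.
  by rewrite /N -!cprecompE es.
- by move=> m s h h'; exact: G_K.
Qed.

End Attach.

(** * From L and R liftings to inner horns *)

Lemma mrlp_trans (T : finType) (r M : rel T) (S S' S'' : subnerve r) (X : msset) :
  (forall m s, S m s -> S' m s) -> mrlp M S S' X -> mrlp M S' S'' X -> mrlp M S S'' X.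
Proof.
move=> SS' l1 l2 F nF mF; have [G [nG [mG eG]]] := l1 F nF mF.
have [H [nH [mH eH]]] := l2 G nG mG; exists H; split=> //; split=> // m s h h'.
by rewrite (eH _ _ (SS' _ _ h)) (eG _ _ h).
Qed.

Section Filling.
Variables (X : msset) (r : forall n, rel {set 'I_n.+1}).
Arguments r {n}.
Hypothesis hr : incl_or_rev (@r).
Variables (n : nat) (k : 'I_n.+1) (mu : {set 'I_n.+1} -> nat).
Hypothesis mu_convex : forall A B C : {set 'I_n.+1},
  A \subset B -> B \subset C -> mu A = mu C -> mu B = mu A.
Hypothesis mu_D : mu [set~ k] = mu setT.
Hypotheses (qX : is_quasicat X) (wX : weakly_closed X).

Local Notation T := {set 'I_n.+1}.
Let M : rel T := fun A B => mu A == mu B.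
Let rn : rel T := @r n.
Implicit Types (A B : T) (C : {set T}) (K : {set {set T}}).

Definition flags : {set {set T}} :=
  [set C : {set T} | [forall A in C, forall B in C, (A \subset B) || (B \subset A)]
           && [forall A in C, (A != set0) && (A != [set~ k])]].

(** The map is given on the flags without [n], and the lifting property reaches those whose members
    all contain [k]; the remaining flags are attached as cells. *)
Definition base_flags : {set {set T}} :=
  [set C : {set T} in flags | (setT \notin C) || [forall A in C, k \in A]].

(** Members of a flag are nested, so this union is the largest member without [k], and it is empty
    when there is none. *)
Definition top_avoiding C : T := \bigcup_(A in C | k \notin A) A.

(* The cells are attached in pairs [C], [pivot C |: C] with [pivot C \notin C]. *)
Definition pivot C : T := k |: top_avoiding C.

(** Members without [k] count twice, so exchanging [top_avoiding C] for the pivot lowers the weight;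
    that face of a cell is thus present before the cell is attached. *)
Definition weight C : nat := #|C| + #|[set A in C | k \notin A]|.

Lemma flagsP C : reflect ((forall A B, A \in C -> B \in C -> A \subset B \/ B \subset A) /\
    (forall A, A \in C -> A != set0 /\ A != [set~ k])) (C \in flags).
Proof.
rewrite inE; apply: (iffP andP) => -[h1 h2]; split.
- move=> A B hA hB; apply/orP.
  by move/forall_inP/(_ _ hA)/forall_inP/(_ _ hB): h1.
- by move=> A hA; apply/andP; move/forall_inP: h2; apply.
- by apply/forall_inP => A hA; apply/forall_inP => B hB; apply/orP; apply: h1.
- by apply/forall_inP => A hA; apply/andP; apply: h2.
Qed.

Lemma flags_down C C' : C \subset C' -> C' \in flags -> C \in flags.
Proof.
move=> /subsetP CC' /flagsP [h1 h2]; apply/flagsP; split.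
  by move=> A B /CC' hA /CC' hB; apply: h1.
by move=> A /CC'; apply: h2.
Qed.

Lemma top_avoiding_mem C A : C \in flags -> A \in C -> k \notin A -> top_avoiding C \in C.
Proof.
move=> /flagsP [tot _] AinC kA.
have PA : (A \in C) && (k \notin A) by rewrite AinC.
case: (@arg_maxnP _ A (fun A => (A \in C) && (k \notin A)) (fun A => #|A|) PA) => B.
move=> /andP [BinC kB] maxB; have -> : top_avoiding C = B; last by [].
apply/eqP; rewrite eqEsubset; apply/andP; split; last first.
  by apply: (bigcup_max B) => //; rewrite BinC.
apply/bigcupsP => A' /andP [AinC' kA'].
case: (tot _ _ AinC' BinC) => // BA'.
suff -> : B = A' by [].
by apply/eqP; rewrite eqEcard BA' /=; apply: maxB; rewrite AinC'.
Qed.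

Lemma top_avoiding_avoids C : k \notin top_avoiding C.
Proof. by apply/bigcupP => -[A /andP [_ /negP]]. Qed.

Lemma sub_top_avoiding C A : A \in C -> k \notin A -> A \subset top_avoiding C.
Proof. by move=> AinC kA; apply: (bigcup_max A) => //; rewrite AinC. Qed.

Lemma pivot_in C : k \in pivot C.
Proof. exact: setU11. Qed.

(** The pairing is stable under faces that retain [top_avoiding C]. *)
Lemma pivotD1 C A : top_avoiding C \in C :\ A -> pivot (C :\ A) = pivot C.
Proof.
move=> aC; congr (_ |: _); apply/eqP; rewrite eqEsubset; apply/andP; split.
  apply/bigcupsP => B /andP [/setD1P [_ BinC] kB]; exact: sub_top_avoiding.
by apply: sub_top_avoiding => //; exact: top_avoiding_avoids.
Qed.

Lemma weightD1 C A : A \in C -> weight C = weight (C :\ A) + 1 + (k \notin A).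
Proof.
move=> AinC; rewrite /weight (cardsD1 A C) AinC (cardsD1 A [set _ in C | _]) inE AinC /=.
rewrite (_ : [set B in C :\ A | k \notin B] = [set B in C | k \notin B] :\ A).
  by rewrite addnACA addnC addnA.
by apply/setP => B; rewrite !inE andbA.
Qed.

Lemma in_base C :
  (C \in base_flags) = (C \in flags) && ((setT \notin C) || [forall A in C, k \in A]).
Proof. by rewrite in_set. Qed.

Lemma notin_base C : C \in flags -> C \notin base_flags ->
  setT \in C /\ exists2 A, A \in C & k \notin A.
Proof.
move=> hC; rewrite in_base hC /= negb_or negbK => /andP [TC /forallPn [A]].
by rewrite negb_imply => /andP [AinC kA]; split=> //; exists A.
Qed.

Lemma notin_baseI C A : setT \in C -> A \in C -> k \notin A -> C \notin base_flags.
Proof.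
move=> TC AinC kA; rewrite in_base TC /= negb_and; apply/orP; right.
by apply/forallPn; exists A; rewrite negb_imply AinC.
Qed.

Lemma rn_refl : reflexive rn.
Proof. by case: hr => e A; rewrite /rn e. Qed.

Lemma rn_trans : transitive rn.
Proof.
by case: hr => e B A D; rewrite /rn !e => h1 h2;
  [exact: subset_trans h1 h2 | exact: subset_trans h2 h1]. Qed.

Lemma rn_anti : antisymmetric rn.
Proof.
by case: hr => e A B; rewrite /rn !e => /andP [h1 h2]; apply/eqP; rewrite eqEsubset h1 h2.
Qed.

Lemma rn_total A B : A \subset B \/ B \subset A -> rn A B || rn B A.
Proof. by case: hr => e; rewrite /rn !e => -[] ->; rewrite ?orbT. Qed.

Lemma M_convex (A B C D : T) : rn A B -> rn B C -> rn C D -> M A D -> M B C.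
Proof.
by case: hr => e; rewrite /rn !e /M => h1 h2 h3 /eqP AD;
  [rewrite (mu_convex h1 (subset_trans h2 h3) AD) (mu_convex (subset_trans h1 h2) h3 AD)
  |rewrite (mu_convex (subset_trans h3 h2) h1 (esym AD)) (mu_convex h3 (subset_trans h2 h1) (esym AD))].
Qed.

(** * Attaching the cell of a missing flag of minimal weight *)

Section Step.
Variable K : {set {set T}}.
Hypotheses (Kbase : base_flags \subset K) (Kflags : K \subset flags).
Hypothesis Kdown : forall C C' : {set T}, C \subset C' -> C' \in K -> C \in K.
Hypothesis Kpair : forall C, C \in K -> C \notin base_flags -> pivot C \notin C ->
  pivot C |: C \in K.
Variable C : {set T}.
Hypotheses (Cflags : C \in flags) (CK : C \notin K).
Hypothesis Cmin : forall C', C' \in flags -> weight C' < weight C -> C' \in K.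

Let v := pivot C.
Let a := top_avoiding C.

Let CT : setT \in C.
Proof. by have [] := notin_base Cflags (contra (subsetP Kbase C) CK). Qed.

Let aC : a \in C.
Proof.
have [_ [A AinC kA]] := notin_base Cflags (contra (subsetP Kbase C) CK).
exact: top_avoiding_mem AinC kA.
Qed.

Let ka : k \notin a := top_avoiding_avoids C.

(** If the pivot were [n], then [a] would be [[set~ k]], which flags exclude. *)
Let vT : v != setT.
Proof.
apply/eqP => eT; have /flagsP [_ /(_ _ aC) [_ /eqP]] := Cflags; apply.
apply/setP => j; rewrite !inE; case: (eqVneq j k) => [->|jk] /=; first exact/negbTE.
by move/setP: eT => /(_ j); rewrite !inE (negbTE jk).
Qed.

Let av : a != v.
Proof. by apply: contraNneq ka => ->; exact: pivot_in. Qed.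

(** Otherwise the lighter flag [C :\ v] is in [K], and adding its pivot [v] puts [C] in [K]. *)
Lemma minimal_pivot_notin : v \notin C.
Proof.
apply: contra CK => vC.
have aD : a \in C :\ v by rewrite !inE av.
have ev : pivot (C :\ v) = v by exact: pivotD1.
rewrite -(setD1K vC) -{1}ev; apply: Kpair.
- apply: Cmin; first exact: flags_down (subsetDl _ _) Cflags.
  by rewrite (weightD1 vC) -addnA add1n addnS ltnS leq_addr.
- by apply: (@notin_baseI _ a) => //; rewrite !inE CT eq_sym vT.
- by rewrite ev !inE eqxx.
Qed.

(** Members without [k] lie below [a], hence below [v]; a member with [k] contains [a], hence
    contains [v]. *)
Lemma minimal_cell_flag : v |: C \in flags.
Proof.
have /flagsP [tot ne] := Cflags.
have vtot A : A \in C -> A \subset v \/ v \subset A.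
  move=> AinC; case: (boolP (k \in A)) => kA; last first.
    by left; apply: subset_trans (subsetUr _ _); exact: sub_top_avoiding.
  case: (tot _ _ AinC aC) => h; last by right; rewrite subUset sub1set kA.
  by case/negP: ka; exact: (subsetP h).
apply/flagsP; split.
- move=> A B /setU1P [->|hA] /setU1P [->|hB]; first by left.
  + by case: (vtot _ hB); [right | left].
  + exact: vtot.
  + exact: tot.
- move=> A /setU1P [->|hA]; last exact: ne.
  split; first by apply/set0Pn; exists k; exact: pivot_in.
  by apply/eqP => /setP /(_ k); rewrite pivot_in !inE eqxx.
Qed.

(** Without [n] the face lies in [base_flags]; without [a] it is lighter than [C]; otherwise it is
    the partner of the lighter flag [C :\ w]. *)
Lemma minimal_cell_face w : w \in v |: C -> w != v -> (v |: C) :\ w \in K.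
Proof.
move=> /setU1P [->|wC wv]; first by rewrite eqxx.
have [/(subsetP Kbase) //|nb] := boolP ((v |: C) :\ w \in base_flags).
have fl : (v |: C) :\ w \in flags := flags_down (subsetDl _ _) minimal_cell_flag.
have [/setD1P [Tw _] _] := notin_base fl nb.
(* Adding [v] raises the weight by one and deleting [a] lowers it by two. *)
have [ewa|wa] := eqVneq w a.
  apply: Cmin => //.
  have h1 : weight (v |: C) = (weight C).+1.
    rewrite (@weightD1 (v |: C) v) ?setU11 // setU1K ?minimal_pivot_notin //.
    by rewrite addn0 addn1.
  have := @weightD1 (v |: C) w; rewrite setU1r // h1 ewa ka => /(_ isT).
  by rewrite !addn1 => -[->].
have aD : a \in C :\ w by rewrite !inE eq_sym wa.
have ev : pivot (C :\ w) = v by exact: pivotD1.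
have -> : (v |: C) :\ w = pivot (C :\ w) |: (C :\ w).
  rewrite ev; apply/setP => A; rewrite !inE; case: (eqVneq A v) => [->|//].
  by rewrite eq_sym wv.
apply: Kpair.
- apply: Cmin; first exact: flags_down (subsetDl _ _) Cflags.
  by rewrite (weightD1 wC) -addnA add1n addnS ltnS leq_addr.
- by apply: (@notin_baseI _ a) => //; rewrite !inE CT Tw.
- by rewrite ev !inE (negbTE minimal_pivot_notin) andbF.
Qed.

Lemma attach_minimal_cell :
  mrlp M (@nerve_of _ rn K) (nerve_of (K :|: [set v |: C; (v |: C) :\ v])) X.
Proof.
have /flagsP [tot _] := minimal_cell_flag.
have av' : a \subset v by exact: subsetUr.
apply: (attach_inner_cell rn_refl rn_trans rn_anti qX wX Kdown).
- by move=> A B hA hB; apply: rn_total; apply: tot.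
- exact: setU11.
- case: hr => e; [exists a | exists setT]; rewrite ?setU1r //.
    by rewrite av /rn e.
  by rewrite eq_sym vT /rn e subsetT.
- case: hr => e; [exists setT | exists a]; rewrite ?setU1r //.
    by rewrite eq_sym vT /rn e subsetT.
  by rewrite av /rn e.
- by rewrite setU1K // minimal_pivot_notin.
- exact: minimal_cell_face.
- by move=> A B D E _ _; exact: M_convex.
Qed.

End Step.

(** A missing flag of least weight is attached together with its partner. Closure under faces and
    under adding pivots is preserved, and the number of missing flags decreases. *)
Lemma fill_flags K : base_flags \subset K -> K \subset flags ->
  (forall C C' : {set T}, C \subset C' -> C' \in K -> C \in K) ->
  (forall C, C \in K -> C \notin base_flags -> pivot C \notin C -> pivot C |: C \in K) ->
  mrlp M (@nerve_of _ rn K) (nerve_of flags) X.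
Proof.
have [N] := ubnP #|flags :\: K|; elim: N K => // N IH K hN Kbase Kflags Kdown Kpair.
have [fK|/subsetPn [C0 C0f C0K]] := boolP (flags \subset K).
  have -> : K = flags by apply/eqP; rewrite eqEsubset Kflags.
  by move=> F nF mF; exists F; split=> //; split=> // m s h h'; rewrite (bool_irrelevance h h').
have P0 : (C0 \in flags) && (C0 \notin K) by rewrite C0f.
case: (@arg_minnP _ C0 (fun C => (C \in flags) && (C \notin K)) weight P0) => C.
move=> /andP [Cf CK] minC.
have Cmin C' : C' \in flags -> weight C' < weight C -> C' \in K.
  by move=> hC'; apply: contraTT => nC'; rewrite -leqNgt; apply: minC; rewrite hC'.
have vC := minimal_pivot_notin Kbase Kpair Cf CK Cmin.
have tf := minimal_cell_flag Kbase Cf CK.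
have face := minimal_cell_face Kbase Kpair Cf CK Cmin.
have step := attach_minimal_cell Kbase Kdown Kpair Cf CK Cmin.
apply: (mrlp_trans _ step); first by move=> m s; rewrite /nerve_of inE => ->.
have eC : (pivot C |: C) :\ pivot C = C by rewrite setU1K.
rewrite eC in step *.
apply: IH.
- rewrite -ltnS; apply: leq_trans hN; rewrite ltnS; apply: proper_card.
  apply/properP; split; first by apply: setDS; exact: subsetUl.
  by exists C; [rewrite in_setD CK Cf | rewrite in_setD in_setU set22 orbT].
- exact: subset_trans Kbase (subsetUl _ _).
- by rewrite subUset Kflags subUset !sub1set tf Cf.
- move=> D D' DD' D'K'.
  have [D'K|D't] : D' \in K \/ D' \subset pivot C |: C.
    move: D'K'; rewrite !inE => /orP [|/orP [] /eqP ->]; [by left|by right|right].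
    exact: subsetUr.
    by rewrite inE (Kdown _ _ DD' D'K).
  have Dt := subset_trans DD' D't.
  (* A face of the new cell either contains [C], so is [C] or the cell, or misses some [w] other
     than the pivot and lies in a face already in [K]. *)
  have [h|] := boolP ((pivot C |: C) :\ pivot C \subset D).
    rewrite eC in h; rewrite !inE; apply/orP; right.
    case: (boolP (pivot C \in D)) => vD; apply/orP; [left|right]; rewrite eqEsubset ?Dt ?h ?andbT //.
      by rewrite subUset sub1set vD.
    apply/subsetP => A AD; have /setU1P [eA|//] := subsetP Dt _ AD.
    by rewrite -eA AD in vD.
  move=> /subsetPn [w /setD1P [wv wt] wD]; rewrite inE (Kdown _ ((pivot C |: C) :\ w)) ?face //.
  apply/subsetP => A AD; rewrite in_setD1 (subsetP Dt) // andbT.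
  by apply: contraNneq wD => <-.
- move=> D; rewrite inE => /orP [DK nb vD|]; first by rewrite inE Kpair.
  rewrite inE => /orP [] /set1P -> nb; last by rewrite !inE eqxx orbT.
  (* The new cell has the same pivot as [C] and contains it, contrary to the assumption on [D]. *)
  have -> : pivot (pivot C |: C) = pivot C; last by rewrite setU11.
  rewrite -[in RHS]eC pivotD1 //.
  have [TC [A AinC kA]] := notin_base tf nb.
  rewrite in_setD1 (top_avoiding_mem tf AinC kA) andbT.
  apply/eqP => e; have := top_avoiding_avoids (pivot C |: C); by rewrite e pivot_in.
Qed.

(** * Extension to the base flags and reinsertion of [[set~ k]] *)

Lemma img_flags m (s : chain rn m) :
  (img s \in flags) = [forall i, (sval s i != set0) && (sval s i != [set~ k])].
Proof.
apply/flagsP/forallP => [[_ h] i|h]; first by apply/andP; apply: h; exact: mem_img.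
split; last by move=> A /imsetP [i _ ->]; apply/andP; exact: h.
have tot (i j : 'I_m.+1) : (i <= j)%N -> sval s i \subset sval s j \/ sval s j \subset sval s i.
  by move=> ij; have := chain_le s ij; case: hr => e; rewrite /rn e; [left|right].
move=> A B /imsetP [i _ ->] /imsetP [j _ ->].
by case/orP: (leq_total i j) => /tot // -[]; [right|left].
Qed.

Definition proper_flags : subnerve rn := fun m s => (img s \in flags) && (setT \notin img s).

(** The base is the union of the proper flags and of L, which overlap in LJ; the given map and its
    lift agree there and are glued. *)
Lemma proper_base_mrlp :
  mrlp M (@LJsub n k rn) (@Lsub n k rn) X -> mrlp M proper_flags (nerve_of base_flags) X.
Proof.
move=> lift F nF mF.
have LJ_proper m (s : chain rn m) : LJsub k s -> proper_flags s.
  move=> /forallP h; rewrite /proper_flags img_flags; apply/andP; split.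
    apply/forallP => i; have /andP [ki _] := h i; apply/andP; split.
      by apply/set0Pn; exists k.
    by apply: contraL ki => /eqP ->; rewrite !inE eqxx.
  by apply/imsetP => -[i _ e]; have /andP [_] := h i; rewrite -e eqxx.
have [H [nH [mH eH]]] := lift (fun m s h => F m s (LJ_proper m s h))
  (fun m p t s h h' => nF m p t s _ _) (fun e h => mF e _).
have proper m (s : chain rn m) : nerve_of base_flags s -> setT \notin img s -> proper_flags s.
  by rewrite /nerve_of in_base => /andP [hs _] hT; rewrite /proper_flags hs.
have inL m (s : chain rn m) : nerve_of base_flags s -> setT \in img s -> Lsub k s.
  rewrite /nerve_of in_base => /andP [_ /orP [/negP //|/forall_inP h]] _.
  by apply/forallP => i; apply: h; exact: mem_img.
pose G m s (h : nerve_of base_flags s) : X m :=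
  match boolP (setT \in img s) with
  | AltTrue hT => H m s (inL m s h hT)
  | AltFalse hT => F m s (proper m s h hT)
  end.
have G_F m s h hF : G m s h = F m s hF.
  rewrite /G; case: {-}_ / boolP => hT; last by apply: (subnerve_map_eq F).
  by case/andP: (hF) => _ /negP.
have G_H m s h hH : G m s h = H m s hH.
  rewrite /G; case: {-}_ / boolP => hT; first by apply: (subnerve_map_eq H).
  have hLJ : LJsub k s.
    apply/forallP => i; rewrite (forallP hH i) /=; apply: contraNneq hT => <-.
    exact: mem_img.
  by rewrite (eH _ _ hLJ); apply: (subnerve_map_eq F).
exists G; split; [|split].
- move=> m p t s h h'; have [hT|hT] := boolP (setT \in img s).
    have hL := inL _ _ h hT.
    have hL' : Lsub k (cprecomp s t).
      by apply/forallP => i; rewrite cprecompE; exact: (forallP hL).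
    by rewrite (G_H _ _ h hL) (G_H _ _ h' hL'); apply: nH.
  have hT' : setT \notin img (cprecomp s t).
    by apply: contra hT; apply: (subsetP (img_precomp _ _)).
  by rewrite (G_F _ _ h (proper _ _ h hT)) (G_F _ _ h' (proper _ _ h' hT')); apply: nF.
- move=> e h he; have [hT|hT] := boolP (setT \in img e).
    by rewrite (G_H _ _ h (inL _ _ h hT)); apply: mH.
  by rewrite (G_F _ _ h (proper _ _ h hT)); apply: mF.
- by move=> m s h h'; exact: G_F.
Qed.

Lemma L_lifting_sd :
  mrlp M (@LJsub n k rn) (@Lsub n k rn) X -> mrlp M (@sdhorn n k rn) (@sdsub n rn) X.
Proof.
move=> lift.
have step1 : mrlp M proper_flags (nerve_of flags) X.
  apply: (mrlp_trans _ (proper_base_mrlp lift)).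
    by move=> m s /andP [hs hT]; rewrite /nerve_of in_base hs hT.
  apply: fill_flags => //.
  - by apply/subsetP => C; rewrite in_base => /andP [].
  - move=> C C' CC'; rewrite !in_base => /andP [hC' hB].
    have hC := flags_down CC' hC'; rewrite hC /=; case/orP: hB => hB; apply/orP.
      by left; apply: contra hB; exact: (subsetP CC').
    by right; apply/forall_inP => A AinC; apply: (forall_inP hB); exact: (subsetP CC').
  - by move=> C ->.
(* Sending [[set~ k]] to [n] is monotone since [n] is its only proper superset, and [mu_D] keeps the
   markings. Chains of [sdhorn] are fixed, as their members miss some [j != k]. *)
pose rho A := if A == [set~ k] then setT else A.
have hrho A B : A \subset B -> rho A \subset rho B.
  rewrite /rho => AB; have [//|BD] := eqVneq B [set~ k].
  have [eA|//] := eqVneq A [set~ k]; subst A.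
  apply/subsetP => j _; have [->|jk] := eqVneq j k; last by apply: (subsetP AB); rewrite !inE.
  apply: contraR BD => kB; rewrite eqEsubset AB andbT.
  by apply/subsetP => i iB; rewrite !inE; apply: contraNneq kB => <-.
have mu_rho A : mu (rho A) = mu A by rewrite /rho; case: eqP => // ->.
have horn_proper m (s : chain rn m) : sdhorn k s -> forall i, rho (sval s i) = sval s i.
  move=> /andP [_ /existsP [j /andP [jk /forallP js]]] i; rewrite /rho.
  by case: eqP => // e; have := js i; rewrite e !inE jk.
apply: (mrlp_retract (hf := incl_homo hr hrho) (hg := incl_homo hr (fun A B AB => AB))
  _ _ _ _ _ _ step1).
- move=> m s hs; have es := horn_proper _ _ hs.
  have -> : cmap (incl_homo hr hrho) s = s by apply: chain_eq => i; rewrite cmapE es.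
  case/andP: hs => /forallP s0 /existsP [j /andP [jk /forallP js]].
  rewrite /proper_flags img_flags; apply/andP; split.
    apply/forallP => i; rewrite s0 /=; apply: contraNneq (js i) => ->.
    by rewrite !inE.
  by apply/imsetP => -[i _ e]; have := js i; rewrite -e inE.
- move=> m s /forallP hs; rewrite /nerve_of img_flags; apply/forallP => i.
  rewrite cmapE /rho; case: (eqVneq (sval s i) [set~ k]) => [_|hD]; last by rewrite hs.
  apply/andP; split; first by apply/set0Pn; exists k; rewrite inE.
  by apply/eqP => /setP /(_ k); rewrite !inE eqxx.
- move=> m s /andP []; rewrite img_flags => /forallP hs hT.
  have -> : cmap (incl_homo hr (fun A B AB => AB)) s = s by apply: chain_eq => i; rewrite cmapE.
  apply/andP; split; first by apply/forallP => i; case/andP: (hs i).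
  have [t st] := chain_top hr s.
  (* The largest member is neither [n] nor [[set~ k]], so it misses some [j != k], and so does every
     other member. *)
  have /subsetPn [j jD jt] : ~~ ([set~ k] \subset sval s t).
    have /andP [_ tD] := hs t; apply/negP => Dt.
    have kt : k \in sval s t.
      apply: contraR tD => kt; rewrite eqEsubset Dt andbT.
      by apply/subsetP => i it; rewrite !inE; apply: contraNneq kt => <-.
    case/negP: hT; suff <- : sval s t = setT by exact: mem_img.
    apply/eqP; rewrite -subTset; apply/subsetP => i _.
    by have [->//|ik] := eqVneq i k; apply: (subsetP Dt); rewrite !inE.
  rewrite !inE in jD; apply/existsP; exists j; rewrite jD; apply/forallP => i.
  by apply: contra jt; exact: (subsetP (st i)).
- exact: horn_proper.
- by move=> s _; rewrite /M !mu_rho.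
- by [].
Qed.

End Filling.

(** * Monotonicity of the extrema and conclusion for both orders *)

Lemma smax_sub n (A B : {set 'I_n.+1}) : A \subset B -> (smax A <= smax B)%N.
Proof. by move=> AB; apply/bigmax_leqP => i /(subsetP AB); exact: leq_smax. Qed.

Lemma smin_sub n (A B : {set 'I_n.+1}) : A \subset B -> (smin B <= smin A)%N.
Proof.
by move=> AB; apply: leq_smin => [|i /(subsetP AB)]; [exact: smin_leqn | exact: smin_leq].
Qed.

Theorem theorem7p5 (X : msset) :
  (is_quasicat (Ex_plus X) -> L_lifting X) /\
  (is_quasicat X -> CLF X -> is_quasicat (Ex_plus X)) /\
  (is_quasicat (Ex_op_plus X) -> R_lifting X) /\
  (is_quasicat X -> CRF X -> is_quasicat (Ex_op_plus X)).
Proof.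
split; first exact: Ex_plus_L_lifting.
split; last split; last 1 first.
- move=> qX [wX lX] n k /andP [k0 kn]; apply: Ex_mrlp_rlp.
  have hr : incl_or_rev (@sup_le) by right.
  apply: (L_lifting_sd hr (mu := @smin n)) => //.
  + move=> A B C AB BinC e; apply/eqP; rewrite eqn_leq smin_sub //= e; exact: smin_sub.
  (* Since [0 < k], the minimum remains [0] when [k] is removed. *)
  + by rewrite !(@smin_char _ _ ord0) ?inE // -val_eqE /= eq_sym -lt0n.
  + by apply: lX => //; apply: leq_ltn_trans kn.
- move=> qX [wX lX] n k /andP [k0 kn]; apply: Ex_mrlp_rlp.
  have hr : incl_or_rev (@sub_le) by left.
  apply: (L_lifting_sd hr (mu := @smax n)) => //.
  + by move=> A B C AB BinC e; apply/eqP; rewrite eqn_leq {1}e !smax_sub.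
  (* Since [k < n], the maximum remains [n] when [k] is removed. *)
  + have maxk : ord_max != k by rewrite -val_eqE /= eq_sym neq_ltn kn.
    by rewrite !(@smax_char _ _ ord_max) ?inE // => i _; exact: leq_ord.
  + by apply: lX; [apply: leq_ltn_trans kn | rewrite k0 ltnW].
- exact: Ex_op_plus_R_lifting.
Qed.
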